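(* Let $G$ be a finite simple connected $(q+1)$-regular graph with $n$ vertices and $m$ edges, let $A(G)\subset V(G)\times V(G)$ be a set of arcs with $A(G)\cup A(G)^{-1}=D(G)$, and let $\theta: D(G)\to\mathbb{C}$ satisfy $\theta(e^{-1})=-\theta(e)$ for every $e\in A(G)$ and $\theta(e)=0$ for every $e\in A(G)\cap A(G)^{-1}$. Let $\lambda_1,\ldots,\lambda_n$ be the eigenvalues of ${\bf H}_\theta$ (with multiplicity). Then \[ {\bf Z}_\theta(u)^{-1}=(q+1)^{-n}(1-u^2)^{m-n}\det\big((q+1)(1+u^2){\bf I}_n-2u{\bf H}_\theta\big)=(1-u^2)^{m-n}\prod_{j=1}^n\Big(u^2-\frac{2\lambda_j}{q+1}u+1\Big). \]
   Context: $D(G)=\{(u,v),(v,u): uv\in E(G)\}$ is the set of $2m$ arcs of $G$; for $e=(u,v)$, $o(e)=u$, $t(e)=v$, $e^{-1}=(v,u)$, and $A(G)^{-1}=\{e^{-1}:e\in A(G)\}$. ${\bf S}_\theta$ is the $2m\times 2m$ matrix indexed by $D(G)$ with $(e,f)$-entry $e^{i\theta(f)}$ if $f=e^{-1}$ and $0$ otherwise. ${\bf K}$ is the $n\times 2m$ matrix with $(v,e)$-entry $1/\sqrt{\deg v}$ if $t(e)=v$ and $0$ otherwise; ${\bf C}=2{\bf K}^*{\bf K}-{\bf I}_{2m}$; the twisted Grover matrix is ${\bf U}_\theta={\bf S}_\theta{\bf C}$, and ${\bf Z}_\theta(u)^{-1}=\det({\bf I}_{2m}-u{\bf U}_\theta)$.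 ${\bf H}_\theta$ is the $n\times n$ matrix indexed by $V(G)$ with $(u,v)$-entry $1$ if $(u,v)\in A(G)\cap A(G)^{-1}$, $e^{i\theta(u,v)}$ if $(u,v)\in A(G)\setminus A(G)^{-1}$, $e^{-i\theta(v,u)}$ if $(u,v)\in A(G)^{-1}\setminus A(G)$, $0$ otherwise. *)

(* Defs.v *)
From HB Require Import structures.
From mathcomp Require Import all_boot all_order all_algebra.
From mathcomp Require Import complex.
From mathcomp Require Import reals sequences exp trigo.

Set Implicit Arguments.
Unset Strict Implicit.
Unset Printing Implicit Defensive.

Import GRing.Theory Num.Theory.
Local Open Scope ring_scope.
Local Open Scope complex_scope.

(* e ^ (a + i b) = e ^ a * (cos b + i sin b). *)
Definition cexp (R : realType) (z : R[i]) : R[i] :=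
  let: a +i* b := z in (expR a)%:C * (cos b +i* sin b).

Section Graphs.
Variables (V : finType) (adj : rel V).

Definition simple_graph : Prop := symmetric adj /\ irreflexive adj.

Definition connected_graph : Prop :=
  (0 < #|V|)%N /\ forall x y : V, connect adj x y.

Definition deg (x : V) : nat := #|[set y | adj x y]|.

Definition regular_graph (k : nat) : Prop := forall x : V, deg x = k.

Definition edges : {set {set V}} := [set [set p.1; p.2] | p : V * V & adj p.1 p.2].

Definition arcs : {set V * V} := [set p | [set p.1; p.2] \in edges].

End Graphs.

Definition org (V : finType) (a : V * V) : V := a.1.
Definition tgt (V : finType) (a : V * V) : V := a.2.
Definition rev_arc (V : finType) (a : V * V) : V * V := (tgt a, org a).
Definition rev_arcs (V : finType) (A : {set V * V}) : {set V * V} :=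
  [set rev_arc a | a in A].

(* Rows and columns indexed by V (resp. by D(G)) are numbered through enum_val;
   the number #|arcs adj| of arcs is 2m. The map theta is given on all of V * V,
   but only its values on D(G) are ever used. *)
Section Matrices.
Variables (R : realType) (V : finType) (adj : rel V).
Variables (A : {set V * V}) (theta : V * V -> R[i]).

Local Notation n := #|V|.
Local Notation D := (arcs adj).

Definition arc_of (i : 'I_#|D|) : V * V := enum_val i.
Definition vertex_of (i : 'I_n) : V := enum_val i.

Definition S_mx : 'M[R[i]]_#|D| :=
  \matrix_(i, j)
    if arc_of j == rev_arc (arc_of i) then cexp ('i%C * theta (arc_of j)) else 0.

Definition K_mx : 'M[R[i]]_(n, #|D|) :=
  \matrix_(i, j)
    if tgt (arc_of j) == vertex_of i
    then (1 / Num.sqrt (deg adj (vertex_of i))%:R)%:C else 0.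

Definition C_mx : 'M[R[i]]_#|D| :=
  2 *: ((map_mx Num.conj K_mx)^T *m K_mx) - 1%:M.

Definition U_mx : 'M[R[i]]_#|D| := S_mx *m C_mx.

Definition zeta (u : R[i]) : R[i] := (\det (1%:M - u *: U_mx))^-1.

Definition H_mx : 'M[R[i]]_n :=
  \matrix_(i, j)
    let x := vertex_of i in let y := vertex_of j in
    if (x, y) \in A :&: rev_arcs A then 1
    else if (x, y) \in A :\: rev_arcs A then cexp ('i%C * theta (x, y))
    else if (x, y) \in rev_arcs A :\: A then cexp (- ('i%C * theta (y, x)))
    else 0.

End Matrices.

(* lam lists the eigenvalues of M with algebraic multiplicity. *)
Definition eigenvalues_of (F : fieldType) (n : nat) (M : 'M[F]_n)
    (lam : 'I_n -> F) : Prop :=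
  char_poly M = \prod_(j < n) ('X - (lam j)%:P).

(* Main.v *)
(* S is an involution, K K^* = 1 and (q+1) K S K^* = H. Hence
   (1 - u S) (1 - u U) = (1 - u^2) - 2u (1 - u S) S K^* K, and the identity
   a^n det(a - B C) = a^N det(a - C B) turns the determinant of the right-hand
   side into one of size n, in which K (1 - u S) S K^* = H / (q+1) - u. The
   factor det(1 - u S) is (1 - u^2)^m because S is conjugate to - S. *)

Require Import Defs.
From HB Require Import structures.
From mathcomp Require Import all_boot all_order all_algebra.
From mathcomp Require Import complex.
From mathcomp Require Import reals sequences exp trigo.
From mathcomp Require Import ring zify.

Set Implicit Arguments.
Unset Strict Implicit.
Unset Printing Implicit Defensive.

Import GRing.Theory Num.Theory.
Local Open Scope ring_scope.
Local Open Scope complex_scope.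

(** * Determinant identities for general matrices *)

Lemma det_scalar_sub_mulmx (F : comNzRingType) (N n : nat) (a : F)
    (B : 'M[F]_(N, n)) (C : 'M[F]_(n, N)) :
  a ^+ n * \det (a%:M - B *m C) = a ^+ N * \det (a%:M - C *m B).
Proof.
(* Column elimination of [C] leaves [a - B C]; row elimination, at the cost of a factor [a ^+ n],
   leaves [a - C B]. No inverse of [a] is needed. *)
pose M := block_mx a%:M B C 1%:M.
have detM : \det M = \det (a%:M - B *m C).
  have <- : \det (M *m block_mx 1%:M 0 (- C) 1%:M) = \det M.
    by rewrite det_mulmx det_lblock !det1 !mulr1.
  rewrite mulmx_block !mulmx1 !mul1mx !mulmxN !mulmx0 !add0r subrr.
  by rewrite det_ublock det1 mulr1.
rewrite -detM -(det_scalar n a) -(det_scalar N a).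
have -> : \det (a%:M : 'M_n) = \det (block_mx 1%:M 0 (- C) a%:M : 'M_(N + n)).
  by rewrite det_lblock det1 mul1r.
rewrite -det_mulmx mulmx_block !mul1mx !mul0mx !addr0 mulmx1.
rewrite mulNmx mul_mx_scalar mul_scalar_mx addNr mulNmx addrC.
by rewrite det_ublock.
Qed.

Lemma det_grover_factor (F : comNzRingType) (N n : nat) (x : F)
    (S : 'M[F]_N) (K : 'M[F]_(n, N)) (L : 'M[F]_(N, n)) :
  S *m S = 1%:M -> K *m L = 1%:M ->
  (1 - x ^+ 2) ^+ n
    * (\det (1%:M - x *: S) * \det (1%:M - x *: (S *m (2 *: (L *m K) - 1%:M))))
  = (1 - x ^+ 2) ^+ N * \det ((1 + x ^+ 2)%:M - (2 * x) *: (K *m S *m L)).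
Proof.
move=> SS KL; rewrite -det_mulmx.
set B : 'M_(N, n) := (2 * x) *: ((1%:M - x *: S) *m (S *m L)).
have -> : (1%:M - x *: S) *m (1%:M - x *: (S *m (2 *: (L *m K) - 1%:M)))
    = (1 - x ^+ 2)%:M - B *m K.
  (* The [- 1] in [2 L K - 1] contributes [+ x S], whose product with [1 - x S] is the scalar
     [1 - x ^+ 2]. *)
  have -> : 1%:M - x *: (S *m (2 *: (L *m K) - 1%:M))
      = (1%:M + x *: S) - (2 * x) *: (S *m L *m K).
    rewrite mulmxBr mulmx1 -scalemxAr scalerBr scalerA [x * 2]mulrC mulmxA.
    by rewrite opprB addrA.
  rewrite mulmxBr /B -scalemxAl -scalemxAr !mulmxA; congr (_ - _).
  rewrite mulmxDr mulmx1 mulmxBl mul1mx -scalemxAl -scalemxAr SS scalerA.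
  by rewrite addrA subrK -expr2 raddfB /= scale_scalar_mx mulr1.
rewrite det_scalar_sub_mulmx; congr (_ * \det _).
rewrite /B -scalemxAr mulmxBl mul1mx -scalemxAl [S *m (S *m L)]mulmxA SS mul1mx.
rewrite mulmxBr -scalemxAr KL mulmxA scalerBr opprB addrA.
congr (_ - _); rewrite scalerA scale_scalar_mx -raddfD /=.
by congr (_%:M); ring.
Qed.

(** Conjugation by [T] exchanges [1 - 'X S] and [1 + 'X S], whose product is [1 - 'X ^+ 2]. This
    gives the square of the determinant; in a domain only a sign remains open. *)
Lemma det_1_sub_involution (F : numFieldType) (m : nat) (S T : 'M[F]_m.*2) :
  S *m S = 1%:M -> T *m T = 1%:M -> T *m S *m T = - S ->
  \det (1%:M - 'X *: map_mx polyC S) = (1 - 'X ^+ 2) ^+ m.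
Proof.
move=> SS TT TST; set s := map_mx polyC S; set t := map_mx polyC T.
have ss : s *m s = 1%:M by rewrite -map_mxM SS map_mx1.
have tt : t *m t = 1%:M by rewrite -map_mxM TT map_mx1.
have tst : t *m s *m t = - s by rewrite -!map_mxM TST map_mxN.
have detD : \det (1%:M + 'X *: s) = \det (1%:M - 'X *: s).
  have -> : 1%:M + 'X *: s = t *m (1%:M - 'X *: s) *m t.
    rewrite mulmxBr mulmxBl mulmx1 tt -scalemxAr -scalemxAl tst.
    by rewrite scalerN opprK.
  by rewrite !det_mulmx mulrAC -det_mulmx tt det1 mul1r.
have : \det (1%:M - 'X *: s) ^+ 2 = ((1 - 'X ^+ 2) ^+ m) ^+ 2.
  rewrite expr2 -{1}detD -det_mulmx mulmxDl mul1mx mulmxBr mulmx1.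
  rewrite -scalemxAl -scalemxAr ss scalerA addrA subrK -expr2.
  by rewrite scale_scalar_mx mulr1 -raddfB /= det_scalar -exprM muln2.
move/eqP; rewrite eqf_sqr => /orP[/eqP // | /eqP E].
(* At 0 the minus sign would give 1 = -1. *)
have := congr1 (horner_eval 0) E.
rewrite -det_map_mx rmorphN /= rmorphXn /= map_mxB map_mx1 map_mxZ /=.
rewrite /horner_eval !hornerE scale0r subr0 det1 expr0n subr0 expr1n /=.
move/eqP; rewrite eq_sym -subr_eq0 -opprD oppr_eq0.
by rewrite -[1 + 1]/(2%:R) pnatr_eq0.
Qed.

Lemma det_scalar_sub_eigenvalues (F : fieldType) (n : nat) (M : 'M[F]_n)
    (lam : 'I_n -> F) (a b : F) :
  eigenvalues_of M lam ->
  \det (a%:M - b *: M) = \prod_(j < n) (a - b * lam j).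
Proof.
(* For nonzero [b] the characteristic polynomial is evaluated at [a / b]. *)
move=> eig; have [->|b0] := eqVneq b 0.
  rewrite scale0r subr0 det_scalar -[n in a ^+ n]card_ord -prodr_const.
  by apply: eq_bigr => j _; rewrite mul0r subr0.
have -> : a%:M - b *: M = b *: ((a / b)%:M - M).
  by rewrite scalerBr scale_scalar_mx mulrC divfK.
rewrite detZ; have -> : \det ((a / b)%:M - M) = (char_poly M).[a / b].
  rewrite -/(horner_eval _ _) -det_map_mx; congr (\det _).
  apply/matrixP=> i j; rewrite !mxE /= /horner_eval hornerD hornerN hornerMn.
  by rewrite hornerX hornerC.
rewrite eig horner_prod -[n in b ^+ n]card_ord -prodr_const -big_split /=.
by apply: eq_bigr => j _; rewrite !hornerE mulrBr mulrC divfK.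
Qed.

(** * The complex exponential *)

Section ComplexExponential.
Variable R : realType.

Lemma cexp0 : cexp (0 : R[i]) = 1.
Proof. by rewrite /cexp /= expR0 cos0 sin0 mul1r. Qed.

Lemma cexp_mulN (z : R[i]) : cexp z * cexp (- z) = 1.
Proof.
case: z => a b; rewrite /cexp /= cosN sinN expRN.
have e0 : expR a != 0 by rewrite lt0r_neq0 ?expR_gt0.
rewrite mulrACA -rmorphM divff // rmorph1 mul1r.
apply/eqP; rewrite eq_complex /=; apply/andP; split; apply/eqP.
  by rewrite mulrN opprK -!expr2 cos2Dsin2.
by rewrite mulrN mulrC addNr.
Qed.

End ComplexExponential.

(** * Arcs of the graph and their number *)

Section GraphMatrices.
Variables (R : realType) (V : finType) (adj : rel V) (q : nat).
Variables (A : {set V * V}) (theta : V * V -> R[i]).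
Hypotheses (adj_sym : symmetric adj) (adj_irr : irreflexive adj).
Hypothesis G_regular : regular_graph adj q.+1.
Hypothesis A_arcs : A :|: rev_arcs A = arcs adj.
Hypothesis theta_rev : forall a, a \in A -> theta (rev_arc a) = - theta a.
Hypothesis theta_sym : forall a, a \in A :&: rev_arcs A -> theta a = 0.

Local Notation D := (arcs adj).
Local Notation n := #|V|.
Local Notation m := #|edges adj|.
Local Notation w a := (cexp ('i%C * theta a)).

Lemma rev_arcK : involutive (@rev_arc V).
Proof. by case. Qed.

Lemma set2_eq (a b x y : V) :
  ([set a; b] == [set x; y])
  = ((a == x) && (b == y)) || ((a == y) && (b == x)).
Proof.
apply/eqP/idP => [/setP E|]; last first.
  by case/orP=> /andP[/eqP-> /eqP->] //; rewrite setUC.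
have := E a; have := E b; have := E x; have := E y.
rewrite !inE !eqxx !orbT /= ![x == _]eq_sym ![y == _]eq_sym.
by do 4!case: (_ == _).
Qed.

Lemma mem_arcs (p : V * V) : (p \in D) = adj p.1 p.2.
Proof.
rewrite inE; apply/imsetP/idP => [[r]|ap]; last by exists p; rewrite ?inE.
rewrite inE => ar /eqP; rewrite set2_eq.
by case/orP=> /andP[/eqP-> /eqP->] //; rewrite adj_sym.
Qed.

Lemma mem_rev_arc (p : V * V) : (rev_arc p \in D) = (p \in D).
Proof. by rewrite !mem_arcs adj_sym. Qed.

Lemma mem_rev_arcs (B : {set V * V}) (p : V * V) :
  (p \in rev_arcs B) = (rev_arc p \in B).
Proof.
by rewrite -{1}[p]rev_arcK mem_imset //; apply: inv_inj; apply: rev_arcK.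
Qed.

(** The map from arcs to edges is two-to-one, since there are no loops. *)
Lemma card_arcs_edges : #|D| = m.*2.
Proof.
rewrite -sum1_card (partition_big (fun p => [set p.1; p.2]) (mem (edges adj))).
  rewrite -muln2 -sum_nat_const; apply: eq_bigr => E /imsetP[[x y]].
  rewrite inE /= => axy ->.
  have xy : x != y by apply: contraTneq axy => ->; rewrite adj_irr.
  rewrite sum1_card -[RHS](_ : #|[set (x, y); (y, x)]| = 2); last first.
    by rewrite cards2 xpair_eqE (negPf xy).
  apply: eq_card => -[a b]; rewrite !inE /= unfold_in /= mem_arcs set2_eq /=.
  rewrite !xpair_eqE andbC; case: orP => //= H; case: H.
    by case/andP=> /eqP-> /eqP->; rewrite axy.
  by case/andP=> /eqP-> /eqP->; rewrite adj_sym axy.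
by move=> p; rewrite inE.
Qed.

(** Reversal carries the arcs into [x] to the arcs out of [x], one per neighbour. *)
Lemma card_arcs_into (x : V) : #|[set a in D | tgt a == x]| = q.+1.
Proof.
rewrite -(G_regular x) /deg -(card_imset _ (can_inj (@rev_arcK))).
rewrite -(card_imset [set y | adj x y] (f := fun y => (x, y))); last first.
  by move=> ? ? [].
apply: eq_card => -[a b]; rewrite -/(rev_arcs _) mem_rev_arcs in_set mem_arcs /=.
rewrite adj_sym; apply/andP/imsetP => [[ab /eqP<-]|[y]].
  by exists b; rewrite ?inE.
by rewrite inE => xy [-> ->].
Qed.

Lemma card_arcs_vertices : #|D| = (n * q.+1)%N.
Proof.
rewrite -sum1_card (partition_big (@tgt V) predT) //= -sum_nat_const.
apply: eq_bigr => x _; rewrite -(card_arcs_into x) -sum1_card.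
by apply: eq_bigl => a; rewrite in_set.
Qed.

(** * Arc weights and the entries of H *)

Lemma theta_rev_arcs (a : V * V) : a \in D -> theta (rev_arc a) = - theta a.
Proof.
(* An arc outside [A] has its reverse in [A]. *)
rewrite -A_arcs inE mem_rev_arcs => /orP[/theta_rev //|/theta_rev].
by rewrite rev_arcK => ->; rewrite opprK.
Qed.

Lemma weight_rev (a : V * V) : a \in D -> w a * w (rev_arc a) = 1.
Proof. by move/theta_rev_arcs->; rewrite mulrN cexp_mulN. Qed.

(** The cases of the definition merge: [theta] vanishes where both orientations lie in [A], and
    changes sign from an arc of [A] to its reverse. *)
Lemma H_mxE i j : H_mx A theta i j =
  if (vertex_of i, vertex_of j) \in D
  then w (vertex_of i, vertex_of j) else 0.
Proof.
rewrite mxE -A_arcs; set x := vertex_of i; set y := vertex_of j.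
have := @theta_sym (x, y); have := @theta_rev (y, x).
rewrite /= !inE mem_rev_arcs /rev_arc /=.
case: (_ \in A); case: (_ \in A) => //= [_|->] //; last by rewrite mulrN.
by move=> ->; rewrite // mulr0 cexp0.
Qed.

(** Each row of S has its only nonzero entry at the reverse arc, so products with S collapse to one
    term. *)
Lemma sum_rev_arc (F : V * V -> R[i]) (e : V * V) : e \in D ->
  \sum_(j < #|D|) (if arc_of j == rev_arc e then F (arc_of j) else 0)
  = F (rev_arc e).
Proof.
move=> De; rewrite -(big_enum_val (fun a => if a == rev_arc e then F a else 0)).
rewrite -big_mkcondr (big_pred1 (rev_arc e)) // => a /=.
by case: eqP => [->|]; rewrite ?andbF ?mem_rev_arc ?De.
Qed.

(** * The matrix S *)

Lemma arc_ofP (i : 'I_#|D|) : arc_of i \in D.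
Proof. exact: enum_valP. Qed.

Lemma S_mx_sqr : S_mx adj theta *m S_mx adj theta = 1%:M.
Proof.
apply/matrixP=> i k; rewrite !mxE.
pose F a := w a * (if arc_of k == rev_arc a then w (arc_of k) else 0).
transitivity (F (rev_arc (arc_of i))).
  rewrite -sum_rev_arc ?arc_ofP //; apply: eq_bigr => j _.
  by rewrite !mxE /F; case: ifP => // _; rewrite mul0r.
rewrite /F rev_arcK [arc_of k == _](inj_eq enum_val_inj) eq_sym.
case: eqP => [->|_]; last by rewrite mulr0.
by rewrite mulrC weight_rev ?arc_ofP.
Qed.

(* Conjugation by the signs of an orientation of G negates S, so 1 and -1 have
   the same multiplicity as eigenvalues of S. *)
Lemma S_mx_sign : exists T : 'M[R[i]]_#|D|,
  T *m T = 1%:M /\ T *m S_mx adj theta *m T = - S_mx adj theta.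
Proof.
pose o (a : V * V) : bool := (enum_rank a.1 < enum_rank a.2)%N.
exists (diag_mx (\row_i (-1) ^+ o (arc_of i))); split.
  rewrite mul_mx_diag; apply/matrixP=> i j; rewrite !mxE.
  case: eqP => [->|_]; last by rewrite mul0r.
  by rewrite mulr1n -signr_addb addbb.
rewrite mul_mx_diag mul_diag_mx; apply/matrixP=> i j; rewrite !mxE.
case: eqP => [E|_]; last by rewrite mulr0 mul0r oppr0.
rewrite mulrAC -signr_addb -[RHS]mulN1r; congr (_ * _).
(* Without loops, exactly one of an arc and its reverse increases [enum_rank]. *)
suff -> : o (arc_of i) (+) o (arc_of j) by [].
have := arc_ofP i; rewrite E mem_arcs /o /=; case: (arc_of i) => x y /= axy.
have : enum_rank x != enum_rank y.
  by rewrite (inj_eq enum_rank_inj); apply: contraTneq axy => ->; rewrite adj_irr.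
by rewrite -(inj_eq val_inj) /=; case: ltngtP.
Qed.

(** * The matrix K and the compression of S to vertices *)

Let s : R[i] := (1 / Num.sqrt (q.+1)%:R)%:C.

Lemma sqr_inv_sqrt_degree : s * s = q.+1%:R^-1.
Proof.
rewrite /s -rmorphM div1r -expr2 exprVn sqr_sqrtr ?ler0n //.
by rewrite fmorphV /= rmorph_nat.
Qed.

Lemma K_mxE i j :
  K_mx R adj i j = if tgt (arc_of j) == vertex_of i then s else 0.
Proof. by rewrite mxE G_regular. Qed.

Lemma K_mx_conj : map_mx Num.conj (K_mx R adj) = K_mx R adj.
Proof.
apply/matrixP=> i j; rewrite mxE K_mxE; case: ifP => _; last by rewrite rmorph0.
by rewrite /s; apply/eqP; rewrite eq_complex /= oppr0 !eqxx.
Qed.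

(** An arc has one head, so distinct rows have disjoint supports; each row has [q.+1] nonzero
    entries, all equal to [s]. *)
Lemma K_mx_coisometry : K_mx R adj *m (K_mx R adj)^T = 1%:M.
Proof.
apply/matrixP=> i k; rewrite !mxE.
pose x := vertex_of i.
have [<-|ik] := eqVneq i k; last first.
  rewrite big1 // => j _; rewrite K_mxE mxE K_mxE.
  case: eqP => [->|]; rewrite ?mul0r //.
  by rewrite [_ == _](inj_eq enum_val_inj) (negPf ik) mulr0.
transitivity (\sum_(j < #|D|) if tgt (arc_of j) == x then s * s else 0).
  apply: eq_bigr => j _; rewrite K_mxE mxE K_mxE.
  by case: ifP => // _; rewrite mul0r.
rewrite -(big_enum_val (fun a => if tgt a == x then s * s else 0)).
rewrite -big_mkcondr.
rewrite (eq_bigl (fun a => a \in [set a in D | tgt a == x])); last first.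
  by move=> a; rewrite [RHS]in_set.
rewrite sumr_const card_arcs_into sqr_inv_sqrt_degree -[_ *+ _]mulr_natl divff //.
by rewrite pnatr_eq0.
Qed.

(** A nonzero term at (x, y) needs an arc into x whose reverse ends at y. Only (y, x) qualifies, and
    S gives it the weight of (x, y). *)
Lemma K_S_K_mx :
  K_mx R adj *m S_mx adj theta *m (K_mx R adj)^T = q.+1%:R^-1 *: H_mx A theta.
Proof.
rewrite -mulmxA -sqr_inv_sqrt_degree; apply/matrixP=> i k; rewrite [RHS]mxE H_mxE.
set x := vertex_of i; set y := vertex_of k.
pose G a := w (rev_arc a) * (if tgt (rev_arc a) == y then s else 0).
have SK e : (S_mx adj theta *m (K_mx R adj)^T) e k = G (arc_of e).
  rewrite mxE /G.
  rewrite -(sum_rev_arc (fun a => w a * if tgt a == y then s else 0)) ?arc_ofP //.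
  apply: eq_bigr => j _; rewrite [_^T _ _]mxE K_mxE mxE.
  by case: ifP => // _; rewrite mul0r.
rewrite mxE; under eq_bigr => e _ do rewrite SK K_mxE.
have term (e : 'I_#|D|) : (if tgt (arc_of e) == x then s else 0) * G (arc_of e) =
    if arc_of e == rev_arc (x, y) then s * s * w (rev_arc (arc_of e)) else 0.
  rewrite /G; case: (arc_of e) => a b; rewrite xpair_eqE /= andbC.
  by case: eqP => _; case: eqP => _ /=; ring.
rewrite (eq_bigr _ (fun e _ => term e)); case: ifP => xyD.
  by rewrite (sum_rev_arc (fun a => s * s * w (rev_arc a))) ?rev_arcK.
rewrite mulr0 big1 // => e _; case: eqP => // E.
by have := arc_ofP e; rewrite E mem_rev_arc xyD.
Qed.

(** * The determinant identity over polynomials and its evaluation *)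

Let a : {poly R[i]} := 1 - 'X ^+ 2.

Lemma det_1_sub_S_mx :
  \det (1%:M - 'X *: map_mx polyC (S_mx adj theta)) = a ^+ m.
Proof.
have [T [TT TST]] := S_mx_sign; have SS := S_mx_sqr.
(* The matrix types mention [#|D|], so the matrices are generalized before it is rewritten. *)
move: (S_mx adj theta) T TT TST SS; rewrite card_arcs_edges => S T TT TST SS.
exact: det_1_sub_involution SS TT TST.
Qed.

Let P : {poly R[i]} := \det (1%:M - 'X *: map_mx polyC (U_mx adj theta)).
Let Q : {poly R[i]} :=
  \det ((q.+1%:R * (1 + 'X ^+ 2))%:M - (2 * 'X) *: map_mx polyC (H_mx A theta)).

Lemma one_sub_X2_neq0 : a != 0.
Proof.
apply/eqP => /(congr1 (fun p => p.[0])); rewrite /a !hornerE expr0n subr0.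
by move/eqP; rewrite oner_eq0.
Qed.

Lemma horner_det_U (u : R[i]) : P.[u] = \det (1%:M - u *: U_mx adj theta).
Proof.
rewrite /P -/(horner_eval u _) -det_map_mx map_mxB map_mx1 map_mxZ /=.
rewrite {1}/horner_eval hornerX -map_mx_comp map_mx_id // => z.
by rewrite /= /horner_eval hornerC.
Qed.

Lemma horner_det_H (u : R[i]) :
  Q.[u] = \det ((q.+1%:R * (1 + u ^+ 2))%:M - (2 * u) *: H_mx A theta).
Proof.
rewrite /Q -/(horner_eval u _) -det_map_mx map_mxB map_scalar_mx map_mxZ /=.
rewrite {1 2}/horner_eval !hornerE -map_mx_comp map_mx_id; last first.
  by move=> z; rewrite /= /horner_eval hornerC.
by congr (\det ((_ * _)%:M - (_ * _) *: _)); rewrite -?[_%:R]polyC_natr hornerC.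
Qed.

(* Working with the indeterminate 'X rather than the number u makes 1 - 'X ^+ 2
   cancellable, so that u = 1 and u = -1 are covered as well. *)
Lemma zeta_poly_identity : a ^+ n * (q.+1%:R ^+ n * P) = a ^+ m * Q.
Proof.
have SS : map_mx polyC (S_mx adj theta) *m map_mx polyC (S_mx adj theta) = 1%:M.
  by rewrite -map_mxM S_mx_sqr map_mx1.
have KL : map_mx polyC (K_mx R adj) *m map_mx polyC (K_mx R adj)^T = 1%:M.
  by rewrite -map_mxM K_mx_coisometry map_mx1.
have := det_grover_factor 'X SS KL.
have <- : map_mx polyC (U_mx adj theta) = map_mx polyC (S_mx adj theta) *m
   (2 *: (map_mx polyC (K_mx R adj)^T *m map_mx polyC (K_mx R adj)) - 1%:M).
  rewrite /U_mx /C_mx K_mx_conj map_mxM map_mxB map_mx1 map_mxZ map_mxM.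
  by rewrite /= polyC_natr.
rewrite -!map_mxM K_S_K_mx det_1_sub_S_mx -/P -/a => E.
(* The extra [a ^+ m] is the determinant of [1 - 'X S]; it cancels one half of [a ^+ #|D|]. *)
apply: (mulfI (expf_neq0 m one_sub_X2_neq0)).
rewrite mulrCA [a ^+ m * (_ * P)]mulrCA [LHS]mulrCA.
rewrite E card_arcs_edges -addnn exprD mulrCA -!mulrA; congr (_ * (_ * _)).
(* [q.+1 ^ n] enters the determinant of size n and clears the denominator of H. *)
rewrite -detZ; congr (\det _); rewrite scalerBr scale_scalar_mx; congr (_ - _).
rewrite map_mxZ !scalerA /=; congr (_ *: _).
by rewrite mulrCA -polyC_natr -polyCM mulfV ?pnatr_eq0 // mulr1.
Qed.

(** The exponent m - n may be negative. If n <= m, [a ^+ n] is cancelled before evaluation at [u];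
    otherwise evaluation comes first, and division requires [1 - u ^+ 2] to be nonzero. *)
Lemma det_1_sub_U_mx (u : R[i]) : (0 < n)%N ->
  \det (1%:M - u *: U_mx adj theta) =
  q.+1%:R ^- n * (1 - u ^+ 2) ^ (m%:Z - n%:Z)
    * \det ((q.+1%:R * (1 + u ^+ 2))%:M - (2 * u) *: H_mx A theta).
Proof.
move=> n_gt0; rewrite -horner_det_U -horner_det_H.
have d0 : q.+1%:R ^+ n != 0 :> R[i] by rewrite expf_neq0 ?pnatr_eq0.
have cards : m.*2 = (n * q.+1)%N by rewrite -card_arcs_edges card_arcs_vertices.
have au : a.[u] = 1 - u ^+ 2 by rewrite /a !hornerE.
have [nm|mn] := leqP n m.
  rewrite subzn //= -exprnP -mulrA; apply: (mulfI d0); rewrite mulVKf //.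
  have := zeta_poly_identity; rewrite -{1}(subnK nm) exprD -mulrA [RHS]mulrCA.
  move/(mulfI (expf_neq0 n one_sub_X2_neq0))/(congr1 (fun p => p.[u])).
  by rewrite !hornerM !horner_exp au -polyC_natr hornerC.
have [u1|u1] := eqVneq (1 - u ^+ 2) 0.
  (* Here m < n forces q = 0, so K is square and U = S; both sides vanish, as
     0 ^ (m - n) = 0 for a negative exponent. *)
  rewrite u1 exp0rz subr_eq0 eqz_nat (ltn_eqF mn) mulr0 mul0r.
  have q0 : q = 0%N by nia.
  have Dn : #|D| = n by rewrite card_arcs_vertices q0 muln1.
  have KK : (K_mx R adj)^T *m K_mx R adj = 1%:M.
    have := K_mx_coisometry; move: (K_mx R adj); rewrite Dn => K.
    exact: mulmx1C.
  have PS : P = a ^+ m.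
    rewrite -det_1_sub_S_mx /P /U_mx /C_mx K_mx_conj KK.
    by rewrite scaler_nat mulr2n addrK mulmx1.
  (* Here [0 ^+ m] is 0 because 2m = n(q+1) forces m > 0. *)
  by rewrite PS horner_exp au u1 expr0n; case: (#|_|) cards => //; nia.
have := congr1 (fun p => p.[u]) zeta_poly_identity.
rewrite !hornerM !horner_exp au -polyC_natr hornerC => E.
rewrite expfzDr // -exprnN -exprnP -!mulrA.
by apply: (mulfI d0); rewrite mulVKf // [RHS]mulrCA -E mulKf // expf_neq0.
Qed.

End GraphMatrices.

Theorem theorem9 (R : realType) (V : finType) (adj : rel V) (q : nat)
    (A : {set V * V}) (theta : V * V -> R[i])
    (lam : 'I_#|V| -> R[i]) (u : R[i])
    (G_simple : simple_graph adj)
    (G_connected : connected_graph adj)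
    (G_regular : regular_graph adj q.+1)
    (A_arcs : A :|: rev_arcs A = arcs adj)
    (theta_rev : forall a, a \in A -> theta (rev_arc a) = - theta a)
    (theta_sym : forall a, a \in A :&: rev_arcs A -> theta a = 0)
    (lam_eig : eigenvalues_of (H_mx A theta) lam) :
  let n := #|V| in
  let m := #|edges adj| in
  (zeta adj theta u)^-1
    = (q.+1)%:R ^- n * (1 - u ^+ 2) ^ (m%:Z - n%:Z)
      * \det ((q.+1%:R * (1 + u ^+ 2))%:M - (2 * u) *: H_mx A theta)
  /\
  (q.+1)%:R ^- n * (1 - u ^+ 2) ^ (m%:Z - n%:Z)
      * \det ((q.+1%:R * (1 + u ^+ 2))%:M - (2 * u) *: H_mx A theta)
    = (1 - u ^+ 2) ^ (m%:Z - n%:Z)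
      * \prod_(j < n) (u ^+ 2 - 2 * lam j / q.+1%:R * u + 1).
Proof.
move=> n m; case: G_simple => adj_sym adj_irr; case: G_connected => n_gt0 _.
split.
  (* [invrK] also covers a zero determinant, as the inverse of 0 is 0. *)
  rewrite /zeta invrK.
  exact: (det_1_sub_U_mx adj_sym adj_irr G_regular A_arcs theta_rev theta_sym).
rewrite (det_scalar_sub_eigenvalues _ _ lam_eig) mulrAC mulrC; congr (_ * _).
have d0 : q.+1%:R != 0 :> R[i] by rewrite pnatr_eq0.
(* Each of the n factors absorbs one [q.+1%:R^-1]. *)
rewrite -exprVn -[n in _ ^+ n]card_ord -prodr_const -big_split /=.
by apply: eq_bigr => j _; move: (q.+1%:R) d0 => d d0; field.
Qed.
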